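(* Let $m$ and $f$ be positive integers with $0<f<\binom{m}{3}$. If $\sigma_3(m,f)>0$, then there exist $x_1,x_2,x_3\in\{1,2,\ldots,m-1\}$ such that $$f=\binom{x_1}{3}=\binom{m}{3}-\binom{x_2}{3}=\binom{x_3}{3}+\binom{x_3}{2}(m-x_3).$$
   Context: A $3$-graph is a $3$-uniform hypergraph. For non-negative integers $n,e,m,f$ write $(n,e)\rightarrow_3(m,f)$ if every $3$-graph on $n$ vertices with exactly $e$ edges contains a set of $m$ vertices that spans (induces) exactly $f$ edges. The forcing density of $(m,f)$ is $$\sigma_3(m,f)=\limsup_{n\to\infty}\frac{|\{e : (n,e)\rightarrow_3(m,f)\}|}{\binom{n}{3}},$$ where $e$ ranges over the integers $0\le e\le\binom{n}{3}$. Convention: $\binom{y}{x}=0$ for $y<x$. *)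

(* Defs.v *)
From mathcomp Require Import all_boot all_order all_algebra.
From mathcomp Require Import all_classical all_reals all_analysis.

Set Implicit Arguments.
Unset Strict Implicit.
Unset Printing Implicit Defensive.

Import Order.TTheory GRing.Theory Num.Theory.

(* A 3-graph on the vertex type V is given by its edge set E; the edges induced
   by a vertex set S are E ::&: S, the members of E contained in S. *)
Definition three_graph (V : finType) (E : {set {set V}}) : bool :=
  [forall A in E, #|A| == 3].

Definition arrow3 (n e m f : nat) : bool :=
  [forall E : {set {set 'I_n}}, (three_graph E && (#|E| == e)) ==>
    [exists S : {set 'I_n}, (#|S| == m) && (#|E ::&: S| == f)]].

Definition num_forced3 (m f n : nat) : nat :=
  #|[set e : 'I_('C(n, 3)).+1 | arrow3 n e m f]|.

(* The quotient is 0 for n < 3 (division by 0), which does not affect the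
   limit superior. *)
Definition sigma3 (R : realType) (m f : nat) : \bar R :=
  limn_esup (fun n : nat => ((num_forced3 m f n)%:R / ('C(n, 3))%:R)%:E).

(* Main.v *)
(** Let A be a set of a vertices of an n-set and take all triples meeting A in at
    least c points (c = 1, 2, 3), plus a 3-graph H inside the complement of A.
    An m-set with x points in A spans w(x) + t edges, where w(x) counts triples
    with at least c points in A and t is the number of edges of H it spans.  By
    the deletion method H may have any number O(n^2) of edges while spanning at
    most s - 2 edges on every s <= m vertices.  Consecutive values of a change
    the number of triples by at most n^2, so all e in the middle range are
    attained: if f is not of the form w(x) + t with t <= max(m - x - 2, 0), then
    (m, f) has forcing density 0.  This applies to C(m,3) - f as well, by
    complementation.  Comparing the two representations for suitable c shows
    that f must be exactly w(x) with c = 2 and exactly a binomial coefficient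
    C(x, 3).  The only exception is (m, f) = (4, 2), where one takes for H a
    disjoint union of cliques, in which no 4-set spans exactly 2 edges. *)
Require Import Defs.
From mathcomp Require Import all_boot all_order all_algebra.
From mathcomp Require Import all_classical all_reals all_analysis.
(* Re-imported so that lemma names such as [subsetP] refer to [{set _}]. *)
From mathcomp Require Import fintype finset zify.

Set Implicit Arguments.
Unset Strict Implicit.
Unset Printing Implicit Defensive.

Import Order.TTheory GRing.Theory Num.Theory.

(** * Counting triples *)

Lemma binS3 n : 'C(n.+1, 3) = 'C(n, 3) + 'C(n, 2).
Proof. by rewrite binS. Qed.

Lemma binS2 n : 'C(n.+1, 2) = 'C(n, 2) + n.
Proof. by rewrite binS bin1. Qed.

Lemma bin2_mul2 n : 'C(n, 2) * 2 = n * n.-1.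
Proof. by elim: n => [|n IHn] //; rewrite binS2 mulnDl IHn; case: n {IHn} => //= n; nia. Qed.

Lemma bin3_mul3 n : 'C(n, 3) * 3 = 'C(n, 2) * (n - 2).
Proof.
elim: n => [|[|[|n]] IHn] //; rewrite binS3 mulnDl IHn (binS2 n.+2).
by have := bin2_mul2 n.+2; rewrite !subSS !subn0 /=; nia.
Qed.

Lemma bin2_sqr n : 'C(n, 2) <= n ^ 2.
Proof. by have := bin2_mul2 n; nia. Qed.

Lemma bin3_lower n : (n - 2) ^ 3 <= 6 * 'C(n, 3).
Proof.
have := bin3_mul3 n; have := bin2_mul2 n.
case: n => [|[|n]] //= H2 H3.
rewrite subSS subSS subn0 in H3 *.
have -> : 6 * 'C(n.+2, 3) = n.+2 * n.+1 * n by rewrite -H2; nia.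
by rewrite expnS expnS expn1 mulnA leq_mul2r leq_mul ?orbT //; lia.
Qed.

Lemma subset_card_exists (T : finType) (A : {set T}) k :
  k <= #|A| -> exists2 B : {set T}, B \subset A & #|B| = k.
Proof.
rewrite -bin_gt0 -cards_draws card_gt0 => /set0Pn[B].
by rewrite inE => /andP[BA /eqP kB]; exists B.
Qed.

Section Triples.
Variable V : finType.
Implicit Types (A B S T : {set V}) (E H : {set {set V}}).

Definition triples S : {set {set V}} := [set T : {set V} | T \subset S & #|T| == 3].

Lemma card_triples S : #|triples S| = 'C(#|S|, 3).
Proof. exact: cards_draws. Qed.

Lemma ssetI_monol E H A : E \subset H -> E ::&: A \subset H ::&: A.
Proof. by move=> /subsetP EH; apply/subsetP => T; rewrite !inE => /andP[/EH-> ->]. Qed.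

Lemma card_ssetI_triples E S : E \subset triples setT -> #|E ::&: S| <= 'C(#|S|, 3).
Proof.
move=> /subsetP EV; rewrite -card_triples; apply/subset_leq_card/subsetP => T.
by rewrite !inE => /andP[/EV]; rewrite !inE => /andP[_ ->] ->.
Qed.

Lemma ssetI_setI E S B : E \subset triples B -> E ::&: S = E ::&: (S :&: B).
Proof.
move=> /subsetP EB; apply/setP => T; rewrite !inE subsetI.
by case: (boolP (T \in E)) => //= /EB; rewrite inE => /andP[->]; rewrite andbT.
Qed.

(** A triple [T] corresponds to the pair [(T :&: A, T :\: A)], with inverse given by union. *)
Lemma card_split_triples A S j : j <= 3 ->
  #|[set T in triples S | #|T :&: A| == j]| = 'C(#|S :&: A|, j) * 'C(#|S :\: A|, 3 - j).
Proof.
move=> j3; rewrite -!cards_draws -cardsX.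
rewrite -(card_in_imset (f := fun p : {set V} * {set V} => p.1 :|: p.2)).
  apply: eq_card => T; rewrite inE; apply/idP/imsetP => [|[[X Y]]].
    rewrite inE => /andP[/andP[TS /eqP T3] /eqP Tj].
    exists (T :&: A, T :\: A); last by rewrite setID.
    rewrite !inE /= setSI // setSD // Tj eqxx /=.
    by rewrite -(eqn_add2l j) subnKC // -Tj cardsID T3.
  rewrite !inE /= => /andP[/andP[XS /eqP Xj] /andP[YS /eqP Yj]] ->.
  move: XS YS; rewrite subsetI subsetD => /andP[XS XA] /andP[YS YA].
  have dXY : [disjoint X & Y] by rewrite disjoint_sym (disjointWr XA).
  have [XA0 YA0] : X :&: A = X /\ Y :&: A = set0.
    by split; [apply/setIidPl | apply: disjoint_setI0].
  rewrite subUset XS YS /= setIUl XA0 YA0 setU0 Xj eqxx andbT.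
  by have [_] := leq_card_setU X Y; rewrite dXY Xj Yj subnKC // => /eqP ->.
move=> [X Y] [X' Y'] /=; rewrite !inE /= !subsetI !subsetD.
move=> /andP[/andP[/andP[_ XA] _] /andP[/andP[_ YA] _]].
move=> /andP[/andP[/andP[_ XA'] _] /andP[/andP[_ YA'] _]] eXY.
congr (_, _).
  move/(congr1 (fun Z => Z :&: A)): eXY.
  by rewrite !setIUl !(setIidPl XA, setIidPl XA') !disjoint_setI0 ?setU0.
move/(congr1 (fun Z => Z :\: A)): eXY; rewrite !setDUl.
have /eqP-> : X :\: A == set0 by rewrite setD_eq0.
have /eqP-> : X' :\: A == set0 by rewrite setD_eq0.
by rewrite !set0U !(setDidPl _).
Qed.

Definition wide c A : {set {set V}} := [set T : {set V} | #|T| == 3 & c <= #|T :&: A|].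

Definition wide_count c a b := \sum_(j < 4 | c <= j) 'C(a, j) * 'C(b, 3 - j).

Lemma card_wide c A S : #|wide c A ::&: S| = wide_count c #|S :&: A| #|S :\: A|.
Proof.
pose p T : 'I_4 := inord #|T :&: A|.
rewrite -sum1_card (partition_big p (fun j => c <= j)) /=; last first.
  move=> T; rewrite !inE => /andP[/andP[/eqP T3 cT] _].
  by rewrite inordK // ltnS -T3 subset_leq_card ?subsetIl.
apply: eq_bigr => j cj; rewrite -card_split_triples -1?ltnS // sum1_card.
apply: eq_card => T; rewrite !inE unfold_in /= !inE -!andbA.
case: eqP => T3 /=; last by rewrite andbF.
have TA : #|T :&: A| < 4 by rewrite ltnS -T3 subset_leq_card ?subsetIl.
rewrite -val_eqE /= inordK //.
by case: eqP => [->|]; rewrite ?andbF ?andbT ?cj.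
Qed.
End Triples.

Lemma wide_countE a b c : wide_count c a b =
  (if c <= 0 then 'C(b, 3) else 0) + (if c <= 1 then a * 'C(b, 2) else 0)
  + (if c <= 2 then 'C(a, 2) * b else 0) + (if c <= 3 then 'C(a, 3) else 0).
Proof.
rewrite /wide_count big_mkcond !big_ord_recr big_ord0 /= add0n.
by rewrite (_ : 3 - 1 = 2) // (_ : 3 - 2 = 1) // subnn subn0 !bin0 !bin1 muln1 mul1n.
Qed.

Lemma wide_countE3 a b : wide_count 3 a b = 'C(a, 3).
Proof. by rewrite wide_countE. Qed.

Lemma wide_countE2 a b : wide_count 2 a b = 'C(a, 3) + 'C(a, 2) * b.
Proof. by rewrite wide_countE /= addnC. Qed.

Lemma wide_countE1 a b : wide_count 1 a b = 'C(a, 3) + 'C(a, 2) * b + a * 'C(b, 2).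
Proof. by rewrite wide_countE /=; lia. Qed.

Lemma wide_count_total a b : 'C(a + b, 3) = wide_count 1 a b + 'C(b, 3).
Proof.
rewrite wide_countE1; elim: b => [|b IHb]; first by rewrite addn0 !muln0 !addn0.
rewrite addnS !binS3 IHb !binS2.
have -> : 'C(a + b, 2) = 'C(a, 2) + a * b + 'C(b, 2); last by lia.
by elim: b {IHb} => [|b IHb]; rewrite ?addn0 ?addnS ?binS2 ?IHb; lia.
Qed.

(** When a vertex moves into [A], the new triples are those through it with exactly [c - 1] further
    points in [A] and [3 - c] outside. *)
Lemma wide_countS c a b : 0 < c <= 3 ->
  wide_count c a.+1 b = wide_count c a b.+1 + 'C(a, c.-1) * 'C(b, 3 - c).
Proof.
case: c => [|[|[|[|c]]]] // _; rewrite !wide_countE /= binS3 ?binS2 ?bin0 ?bin1.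
- by rewrite (_ : 3 - 1 = 2) //; lia.
- by rewrite ?bin1; lia.
- by rewrite ?bin0; lia.
Qed.

Lemma wide_count0 c n : 0 < c -> wide_count c 0 n = 0.
Proof. by case: c => // c _; rewrite wide_countE /= !if_same. Qed.

Lemma wide_countn0 c n : c <= 3 -> wide_count c n 0 = 'C(n, 3).
Proof. by move=> c3; rewrite wide_countE c3 !muln0 !if_same. Qed.

(** The window is that of edge densities between 1/d and 1 - 1/d, written without division. *)
Definition mostly_avoidable m f := forall d, exists n0, forall n, n0 <= n ->
  forall e, 'C(n, 3) <= d * e -> 'C(n, 3) <= d * ('C(n, 3) - e) -> ~~ arrow3 n e m f.

(** Forced values lie in the two end intervals left by the window. Each has at most C(n,3)/d + 1
    elements, and [rev_ord] maps one onto the other. *)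
Lemma num_forced3_le m f d n :
  (forall e, 'C(n, 3) <= d * e -> 'C(n, 3) <= d * ('C(n, 3) - e) -> ~~ arrow3 n e m f) ->
  num_forced3 m f n * d <= ('C(n, 3) + d).*2.
Proof.
move=> Hav; set c := 'C(n, 3) in Hav *.
have [->|d0] := posnP d; first by rewrite muln0.
pose A := [set e : 'I_c.+1 | e <= c %/ d].
have cA : #|A| * d <= c + d.
  suff: #|A| <= (c %/ d).+1.
    by move=> AA; apply: leq_trans (leq_mul AA (leqnn d)) _; rewrite mulSn addnC leq_add2r leq_divM.
  rewrite -[X in _ <= X]card_ord -cardsT.
  apply: leq_trans (leq_imset_card (fun j : 'I_(c %/ d).+1 => inord j : 'I_c.+1) _).
  apply/subset_leq_card/subsetP => e; rewrite inE => ecd.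
  by apply/imsetP; exists (inord e) => //; apply: val_inj; rewrite /= !inordK.
have sub : [set e : 'I_c.+1 | arrow3 n e m f] \subset A :|: (@rev_ord _ @: A).
  apply/subsetP => e; rewrite !inE => ae; apply/orP.
  have [h1|h1] := leqP c (d * e); last by left; rewrite leq_divRL // mulnC ltnW.
  right; apply/imsetP; exists (rev_ord e); last by rewrite rev_ordK.
  rewrite inE /= subSS leq_divRL // mulnC leqNgt; apply/negP => h2.
  by have := Hav e h1 (ltnW h2); rewrite ae.
rewrite -addnn; apply: leq_trans (leq_add cA cA); rewrite -mulnDl leq_mul //.
apply: leq_trans (subset_leq_card sub) _; apply: leq_trans (leq_card_setU _ _).1 _.
by rewrite leq_add2l leq_imset_card.
Qed.

(** * Sparse perturbations of threshold 3-graphs *)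

Lemma three_graphE (V : finType) (E : {set {set V}}) :
  three_graph E = (E \subset triples setT).
Proof.
apply/forall_inP/subsetP => [E3 T TE|E3 T /E3]; rewrite inE subsetT //=.
exact: E3.
Qed.

Lemma not_arrow3P n e m f :
  reflect (exists2 E : {set {set 'I_n}}, E \subset triples setT /\ #|E| = e &
             forall S : {set 'I_n}, #|S| = m -> #|E ::&: S| <> f)
          (~~ arrow3 n e m f).
Proof.
rewrite negb_forall; apply: (iffP existsP) => [[E]|[E [E3 Ee] ES]].
  rewrite negb_imply three_graphE => /andP[/andP[E3 /eqP Ee] /existsPn ES].
  by exists E => // S Sm ESf; have := ES S; rewrite Sm ESf !eqxx.
exists E; rewrite negb_imply three_graphE E3 Ee eqxx /=.
apply/existsPn => S; rewrite negb_and; apply/orP.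
by have [/ES /eqP|] := eqVneq #|S| m; [right|left].
Qed.

Lemma card_triplesD_ssetI (V : finType) (E : {set {set V}}) S :
  E \subset triples setT ->
  #|(triples setT :\: E) ::&: S| = 'C(#|S|, 3) - #|E ::&: S|.
Proof.
move=> /subsetP E3.
have -> : (triples setT :\: E) ::&: S = triples S :\: (E ::&: S).
  apply/setP => T; rewrite !inE subsetT /=.
  by case: (T \in E) (T \subset S) => [] [] //=; rewrite ?andbF ?andbT.
rewrite cardsD card_triples (setIidPr _) //; apply/subsetP => T; rewrite !inE.
by case/andP => /E3; rewrite inE => /andP[_ ->] ->.
Qed.

Lemma arrow3_compl n e m f : e <= 'C(n, 3) -> f <= 'C(m, 3) ->
  ~~ arrow3 n e m f -> ~~ arrow3 n ('C(n, 3) - e) m ('C(m, 3) - f).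
Proof.
move=> en fm /not_arrow3P[E [E3 Ee] ES]; apply/not_arrow3P.
exists (triples setT :\: E).
  split; first exact: subsetDl.
  by rewrite cardsD (setIidPr E3) card_triples cardsT card_ord Ee.
move=> S Sm; rewrite card_triplesD_ssetI // Sm => eq.
by apply: (ES S Sm); have := card_ssetI_triples S E3; rewrite Sm; lia.
Qed.

Lemma mostly_avoidable_compl m f : f <= 'C(m, 3) ->
  mostly_avoidable m f -> mostly_avoidable m ('C(m, 3) - f).
Proof.
move=> fm MA d; have [n0 Hn0] := MA d; exists (maxn n0 3) => n.
rewrite geq_max => /andP[n0n n3] e e1 e2.
have C0 : 0 < 'C(n, 3) by rewrite bin_gt0.
have en : e <= 'C(n, 3) by lia.
by rewrite -(subKn en); apply: arrow3_compl; rewrite ?leq_subr // Hn0 // subKn.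
Qed.

(** Common interface for the two choices of [H]: sparse 3-graphs, and disjoint unions of cliques.
    The quadratic range of [r] matches the gaps between consecutive threshold 3-graphs. *)
Definition fillable (P : nat -> nat -> Prop) := forall C, exists N0,
  forall (V : finType) (B : {set V}) r, N0 <= #|B| -> r <= C * #|B| ^ 2 ->
  exists H : {set {set V}}, [/\ H \subset triples B, #|H| = r &
    forall S : {set V}, S \subset B -> P #|S| #|H ::&: S|].

Lemma nat_crossing (h : nat -> nat) n e : h 0 <= e -> e < h n ->
  exists2 k, k < n & h k <= e < h k.+1.
Proof.
elim: n => [|n IHn] h0 hn; first by lia.
have [hne|hne] := leqP (h n) e; first by exists n; rewrite // hne.
by have [k kn hk] := IHn h0 hne; exists k => //; apply: ltnW.
Qed.

Lemma wide_count_step c n k : 0 < c <= 3 -> k < n ->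
  wide_count c k (n - k) <= wide_count c k.+1 (n - k.+1)
    <= wide_count c k (n - k) + n ^ 2.
Proof.
move=> c3 kn; rewrite wide_countS // -subSn // subSS leq_addr leq_add2l /=.
case: c c3 => [|[|[|[|c]]]] // _ /=; rewrite ?bin0 ?bin1 ?mul1n ?muln1.
- by apply: leq_trans (bin2_sqr _) _; rewrite leq_exp2r // leq_subr.
- by rewrite expnS expn1 leq_mul ?leq_subr // ltnW.
- by apply: leq_trans (bin2_sqr _) _; rewrite leq_exp2r // ltnW.
Qed.

(** From [k] there are [n - k] steps to the complete 3-graph, each adding at most n^2 triples. *)
Lemma wide_count_codeficit c n k : 0 < c <= 3 -> k <= n ->
  'C(n, 3) <= wide_count c k (n - k) + (n - k) * n ^ 2.
Proof.
move=> c3; have [l] := ubnP (n - k); elim: l k => [|l IHl] k // nkl.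
rewrite leq_eqVlt => /predU1P[->|kn].
  by rewrite subnn wide_countn0 ?addn0 //; case/andP: c3.
have /andP[_ Hs] := wide_count_step c3 kn.
have := IHl k.+1; rewrite -(subnSK kn) mulSn in nkl Hs *; lia.
Qed.

(** Take the last threshold [k] before [e] is passed and put the missing e - h(k) <= n^2 edges
    outside [A]. As [e] is far from C(n,3), the complement of [A] has linear size, so n^2 is
    quadratic in that size too. *)
Lemma mostly_avoidable_fill c (P : nat -> nat -> Prop) m f :
  0 < c <= 3 -> fillable P ->
  (forall a b t, a + b = m -> P b t -> t <= 'C(b, 3) -> wide_count c a b + t <> f) ->
  mostly_avoidable m f.
Proof.
(* The constant comes from n <= 48d(n - k), where 48 = 6 * 8: 6 from [bin3_lower], and 8 from n <=
   2(n - 2). *)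
move=> c3 fillP avoid d; have [N0 HN0] := fillP ((48 * d) ^ 2).
exists (48 * d * N0 + 4) => n nn e e1 e2.
have n4 : 4 <= n by apply: leq_trans nn; rewrite leq_addl.
have n3 : (n - 2) ^ 3 <= 6 * 'C(n, 3) := bin3_lower n.
have C0 : 0 < 'C(n, 3) by rewrite bin_gt0; lia.
pose h k := wide_count c k (n - k).
have [c0 c3'] := andP c3.
have [||k kn /andP[hk hk1]] := @nat_crossing h n e.
- by rewrite /h wide_count0.
- by rewrite /h subnn wide_countn0 //; lia.
have /andP[_ step] := wide_count_step c3 kn; rewrite -/(h k) -/(h k.+1) in step.
have cod := wide_count_codeficit c3 (ltnW kn); rewrite -/(h k) in cod.
have nk : n <= 48 * d * (n - k).
  have H1 : 'C(n, 3) <= d * ((n - k) * n ^ 2).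
    by apply: leq_trans e2 _; rewrite leq_mul2l leq_subLR (leq_trans cod) ?leq_add2r ?orbT.
  have H2 : n ^ 3 <= 8 * (n - 2) ^ 3.
    by rewrite -[8]/(2 ^ 3) -expnMn leq_exp2r //; lia.
  have H3 : n * n ^ 2 <= (48 * d * (n - k)) * n ^ 2 by rewrite -expnS; lia.
  by rewrite leq_pmul2r ?expn_gt0 // in H3; lia.
have d0 : 0 < d by lia.
pose A : {set 'I_n} := [set i : 'I_n | i < k].
have cA : #|A| = k.
  have -> : A = [set widen_ord (ltnW kn) j | j : 'I_k].
    apply/setP => i; rewrite inE; apply/idP/imsetP => [ik|[j _ ->]]; last exact: (ltn_ord j).
    by exists (Ordinal ik) => //; apply: val_inj.
  by rewrite card_imset ?card_ord // => i j /(congr1 val) /= /val_inj.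
have cB : #|~: A| = n - k by rewrite cardsCs setCK card_ord cA.
have [||H [H3 Hr HS]] := @HN0 'I_n (~: A) (e - h k); rewrite ?cB.
- by have := leq_trans nn (leq_trans (leqnn n) nk); nia.
- have : n ^ 2 <= (48 * d * (n - k)) ^ 2 by rewrite leq_exp2r.
  by rewrite expnMn; lia.
have dis S : (wide c A ::&: S) :&: (H ::&: S) = set0.
  apply/setP => T; rewrite !inE; apply/negP => /andP[/andP[/andP[_ cT] _] /andP[/(subsetP H3)]].
  rewrite inE -disjoints_subset => /andP[/disjoint_setI0 TA _] _.
  by move: cT; rewrite TA cards0 leqNgt c0.
have cE S : #|(wide c A :|: H) ::&: S| = wide_count c #|S :&: A| #|S :\: A| + #|H ::&: (S :\: A)|.
  have -> : (wide c A :|: H) ::&: S = (wide c A ::&: S) :|: (H ::&: S).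
    by apply/setP => T; rewrite !inE andb_orl.
  by rewrite cardsU dis cards0 subn0 card_wide (ssetI_setI S H3) setDE.
apply/not_arrow3P; exists (wide c A :|: H).
  split.
    rewrite subUset; apply/andP; split; apply/subsetP => T.
      by rewrite !inE subsetT => /andP[].
    by move/(subsetP H3); rewrite !inE subsetT => /andP[_].
  have ET (F : {set {set 'I_n}}) : F ::&: setT = F by apply/setP => T; rewrite inE subsetT andbT.
  have HB := ssetI_setI setT H3; rewrite setTI ET in HB.
  by have := cE setT; rewrite setTI setTD cA cB ET -HB Hr => ->; rewrite subnKC.
move=> S Sm; rewrite cE; apply: avoid.
- by rewrite cardsID.
- by apply: HS; rewrite setDE subsetIr.
- apply: card_ssetI_triples; apply: subset_trans H3 _; apply/subsetP => T.
  by rewrite !inE subsetT => /andP[].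
Qed.

(** * Sparse 3-graphs *)

Lemma bin_leq_exp n k : 'C(n, k) <= n ^ k.
Proof.
elim: n k => [|n IHn] [|k] //; rewrite binS.
apply: leq_trans (leq_add (IHn _) (IHn _)) _.
rewrite [n ^ k.+1]expnS -mulSnr expnS leq_mul //.
by case: k => // k; rewrite leq_exp2r.
Qed.

(** Counting form of the fact that independent uniform colours all vanish on [X] with probability
    (q+1)^(-|X|). *)
Lemma card_null_colourings (U : finType) q (X : {set U}) :
  #|[set c : {ffun U -> 'I_q.+1} | X \subset [set x | c x == ord0]]|
    = q.+1 ^ (#|U| - #|X|).
Proof.
have <- : #|~: X| = #|U| - #|X| by rewrite cardsCs setCK.
rewrite -[in RHS](card_ord q.+1) -(card_pffun_on ord0).
apply: eq_card => c; rewrite inE; apply/subsetP/pffun_onP => [Xc|[sc _] x xX].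
  split=> //; apply/subsetP => x; rewrite !inE; apply: contra => /Xc.
  by rewrite inE.
by rewrite inE; apply: contraTT (xX) => cx; have := subsetP sc x cx; rewrite inE.
Qed.

Section SparseSubgraph.
Variables (V : finType) (B : {set V}) (m q D L : nat).
Hypothesis cardB : #|B| = D * q.+1.

Let M := #|{set V}|.
Let K := \sum_(s < m.+1) 2 ^ 2 ^ m * D ^ s.
Let colouring := {ffun {set V} -> 'I_q.+1}.
Let zeros (c : colouring) := [set T in triples B | c T == ord0].

(** Minimal obstructions to sparsity: a set of s points together with s - 1 triples in it. *)
Definition dense_pairs : {set {set V} * {set {set V}}} :=
  [set p : {set V} * {set {set V}} | [&& p.1 \subset B, 2 < #|p.1| <= m, p.2 \subset triples p.1
             & #|p.2| == #|p.1|.-1]].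

Lemma dense_pairs_zeros p c : p \in dense_pairs ->
  (p.2 \subset zeros c) = (p.2 \subset [set T | c T == ord0]).
Proof.
rewrite inE => /and4P[p1B _ p2 _]; rewrite /zeros.
have -> : [set T in triples B | c T == ord0] = triples B :&: [set T | c T == ord0].
  by apply/setP => T; rewrite !inE.
rewrite subsetI; case: subsetP => // -[T /(subsetP p2)]; rewrite !inE.
by case/andP => /subset_trans ->.
Qed.

Lemma card_dense_pairs (s : 'I_m.+1) :
  #|[set p in dense_pairs | #|p.1| == s]| <= 'C(D * q.+1, s) * 2 ^ 2 ^ m.
Proof.
rewrite -cardB -cards_draws -sum1_card.
rewrite (partition_big fst [in [set S : {set V} | S \subset B & #|S| == s]]) /=; last first.
  by move=> [S X]; rewrite !inE /= => /andP[/and4P[-> _ _ _] ->].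
rewrite -sum_nat_const leq_sum // => S; rewrite inE => /andP[SB /eqP Ss].
rewrite sum1_card.
apply: (@leq_trans #|setX [set S] (powerset (powerset S))|).
  apply/subset_leq_card/subsetP => -[S' X]; rewrite unfold_in /= !inE /=.
  move=> /andP[/andP[/and4P[_ _ /subsetP X3 _] _] /eqP <-]; rewrite eqxx /=.
  by apply/subsetP => T /X3; rewrite !inE => /andP[].
by rewrite cardsX cards1 mul1n !card_powerset !leq_exp2l // Ss -ltnS.
Qed.

(** For each size s there are O((q+1)^s) pairs, each surviving with probability (q+1)^(1-s); so on
    average at most K(q+1) dense pairs survive. *)
Lemma sum_dense_pairs :
  \sum_(c : colouring) #|[set p in dense_pairs | p.2 \subset zeros c]| <= K * q.+1 ^ M.+1.
Proof.
under eq_bigr do rewrite -sum1_card.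
rewrite (exchange_big_dep (fun p => p \in dense_pairs)) /=; last first.
  by move=> c p _; rewrite inE => /andP[].
rewrite (partition_big (fun p : {set V} * {set {set V}} => inord #|p.1| : 'I_m.+1) xpredT) //=.
rewrite big_distrl leq_sum //= => s _.
apply: (@leq_trans (\sum_(p in [set p in dense_pairs | #|p.1| == s]) q.+1 ^ (M - s.-1))).
  rewrite [X in _ <= X](eq_bigl (fun p => (p \in dense_pairs) && (inord #|p.1| == s))); last first.
    move=> p; rewrite !inE; case: and4P => //= -[_ /andP[_ pm] _ _].
    by rewrite -val_eqE /= inordK.
  apply: leq_sum => p /andP[pP /eqP ps]; rewrite sum1_card.
  have [pm /eqP p2] : #|p.1| <= m /\ #|p.2| == #|p.1|.-1.
    by move: pP; rewrite inE => /and4P[_ /andP[]].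
  have -> : (s : nat) = #|p.1| by rewrite -ps inordK.
  rewrite -p2 -card_null_colourings; apply/subset_leq_card/subsetP => c.
  by rewrite unfold_in /= => /setIdP[_]; rewrite inE dense_pairs_zeros.
rewrite sum_nat_const; apply: leq_trans (leq_mul (card_dense_pairs s) (leqnn _)) _.
rewrite mulnAC -[X in _ <= X]mulnA [X in _ <= X]mulnC leq_mul //.
have [sB|sB] := ltnP #|B| s; first by rewrite -cardB bin_small.
apply: leq_trans (leq_mul (bin_leq_exp _ _) (leqnn _)) _.
rewrite expnMn -mulnA leq_mul // -expnD leq_pexp2l //.
(* Ensures that the subtraction in [M - s.-1] is not truncated. *)
have MV : #|V| < M by rewrite /M -[#|{set V}|]cardsT -powersetT card_powerset cardsT ltn_expl.
by have := leq_trans sB (max_card B); lia.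
Qed.

Lemma sum_zeros : \sum_(c : colouring) #|zeros c| = 'C(#|B|, 3) * q.+1 ^ M.-1.
Proof.
under eq_bigr do rewrite -sum1_card.
rewrite (exchange_big_dep [in triples B]) /=; last first.
  by move=> c T _; rewrite inE => /andP[].
rewrite -card_triples -sum_nat_const; apply: eq_bigr => T TB.
rewrite sum1_card -subn1 -(cards1 T) -card_null_colourings; apply: eq_card => c.
rewrite unfold_in /= [RHS]inE sub1set [RHS]inE.
by apply/setIdP/idP => [[]|].
Qed.

(* First-moment argument: [zeros c] is a random set of triples of density
   1/(q+1), from which one triple per dense pair is deleted. *)
Lemma sparse_subgraph : K * q.+1 ^ 2 + L * q.+1 < 'C(#|B|, 3) ->
  exists H : {set {set V}}, [/\ H \subset triples B, L <= #|H| &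
    forall S : {set V}, S \subset B -> #|S| <= m -> #|H ::&: S| <= #|S| - 2].
Proof.
move=> large; pose bad c := [set p in dense_pairs | p.2 \subset zeros c].
have [c Hc] : exists c : colouring, #|bad c| + L < #|zeros c|.
  apply/existsP; apply: contraLR large => /existsPn small; rewrite -leqNgt.
  have M0 : 0 < M by rewrite /M -[#|{set V}|]cardsT -powersetT card_powerset expn_gt0.
  rewrite -(@leq_pmul2r (q.+1 ^ M.-1)) ?expn_gt0 // -sum_zeros.
  apply: (@leq_trans (\sum_(c : colouring) (#|bad c| + L))).
    by apply: leq_sum => c _; rewrite leqNgt.
  rewrite big_split /= sum_nat_const card_ffun card_ord -/M mulnDl.
  apply: leq_add; last by rewrite -mulnA -expnS prednK // mulnC.
  by apply: leq_trans sum_dense_pairs _; rewrite -mulnA -expnD leq_mul // leq_pexp2l //; lia.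
(* The default [set0] never arises: the second component of a dense pair has at least two
   triples. *)
pose R := [set odflt set0 [pick T in p.2] | p : _ * {set {set V}} in bad c].
have cR : #|R| <= #|bad c| := leq_imset_card _ _.
exists (zeros c :\: R); split.
- by apply: subset_trans (subsetDl _ _) _; apply/subsetP => T; rewrite inE => /andP[].
- rewrite cardsD; move: (subset_leq_card (subsetIr (zeros c) R)) cR Hc.
  by move: #|_ :&: _| #|R| #|bad c| #|zeros c| => w x y z; lia.
move=> S SB Sm; rewrite leqNgt; apply/negP => dense.
have HS : (zeros c :\: R) ::&: S \subset triples S.
  by apply/subsetP => T; rewrite !inE => /andP[/and3P[_ /andP[_ ->] _] ->].
have S3 : 2 < #|S|.
  move: (subset_leq_card HS); rewrite card_triples; case: ltnP => // S2.
  by rewrite bin_small //; lia.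
(* Too many surviving triples would contain a whole bad pair, although one of its triples was
   deleted. *)
have [X XH cX] : exists2 X : {set {set V}}, X \subset (zeros c :\: R) ::&: S & #|X| = #|S|.-1.
  by apply: subset_card_exists; lia.
have XD : X \subset zeros c :\: R.
  by apply: subset_trans XH _; apply/subsetP => T; rewrite inE => /andP[].
have Xbad : (S, X) \in bad c.
  by rewrite !inE /= SB S3 Sm (subset_trans XH HS) cX eqxx (subset_trans XD) ?subsetDl.
have : odflt set0 [pick T in X] \in R by apply/imsetP; exists (S, X).
case: pickP => [T TX|X0] /=.
  by have := subsetP XD T TX; rewrite inE => /andP[/negP].
by have : #|X| = 0 by [apply: eq_card0]; lia.
Qed.

End SparseSubgraph.

(** Trim [B] to a multiple of [D], so that a density of 1/(q+1) is of order 1/|B| and leaves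
    quadratically many edges. Dropping edges to reach exactly [r] preserves sparsity. *)
Lemma fillable_sparse m : fillable (fun s t => s <= m -> t <= s - 2).
Proof.
(* With p = q + 1, 6Lp = 96Ca^2p^3, while 6C(Dp,3) >= (ap)^3. The summand 6 leaves 6a^2p^3 to absorb
   6Kp^2, since K < p. *)
move=> C; pose a := 96 * C + 6; pose D := 2 * a.
pose K := \sum_(s < m.+1) 2 ^ 2 ^ m * D ^ s.
exists (D * K.+2) => V B r BN rC.
have D0 : 0 < D by rewrite /D /a; lia.
have [q qK qB] : exists2 q, K <= q & D * q.+1 <= #|B| < D * q.+2.
  have : K.+2 <= #|B| %/ D by rewrite leq_divRL // mulnC.
  case E : (#|B| %/ D) => [//|q] Kq; exists q; first by lia.
  by rewrite mulnC -leq_divRL // E leqnn /= mulnC -ltn_divLR // E.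
have [q1 q2] := andP qB.
have [B' B'B cB'] := subset_card_exists q1.
pose L := C * (2 * (D * q.+1)) ^ 2.
have [|H [H3 LH HS]] := @sparse_subgraph V B' m q D L cB'.
  rewrite -/K cB' -(ltn_pmul2l (isT : 0 < 6)).
  apply: leq_trans (bin3_lower _).
  apply: (@leq_trans ((a * q.+1) ^ 3)); last first.
    by rewrite leq_exp2r //; move: D0; rewrite /D /a; nia.
  rewrite /L /D; set p := q.+1.
  have -> : 6 * (K * p ^ 2 + C * (2 * (2 * a * p)) ^ 2 * p) = (6 * K + 96 * C * a ^ 2 * p) * p ^ 2.
    by rewrite !expnS !expn0; lia.
  have -> : (a * p) ^ 3 = (a ^ 3 * p) * p ^ 2 by rewrite !expnS !expn0; lia.
  rewrite ltn_pmul2r ?expn_gt0 //.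
  have a6 : 6 <= a by rewrite /a leq_addl.
  have -> : a ^ 3 = 96 * C * a ^ 2 + 6 * a ^ 2.
    by rewrite [a ^ 3]expnS -mulnDl.
  have : 0 < a ^ 2 by rewrite expn_gt0; lia.
  have : K < p by rewrite ltnS.
  move: (a ^ 2) (96 * C * a ^ 2); nia.
have rL : r <= #|H|.
  apply: leq_trans rC (leq_trans _ LH); rewrite /L leq_mul // leq_exp2r //.
  by move: q2; rewrite mulnS; nia.
have [H' H'H cH'] := subset_card_exists rL.
exists H'; split => //.
  apply: subset_trans (subset_trans H'H H3) _; apply/subsetP => T; rewrite !inE.
  by case/andP => /subset_trans ->.
move=> S SB Sm; rewrite (ssetI_setI S (subset_trans H'H H3)).
apply: leq_trans (subset_leq_card (ssetI_monol _ H'H)) _.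
apply: leq_trans (HS _ (subsetIr _ _) _) _.
  by apply: leq_trans Sm; apply/subset_leq_card/subsetIl.
by apply: leq_sub2r; apply/subset_leq_card/subsetIl.
Qed.

(** * The pair (4, 2) *)

Lemma bin3_small : ('C(0, 3) = 0) * ('C(1, 3) = 0) * ('C(2, 3) = 0) * ('C(3, 3) = 1)
  * ('C(4, 3) = 4).
Proof. by []. Qed.

Section FourTwo.
Variable V : finType.
Implicit Types (B S : {set V}).

Definition fills42 B r := exists H : {set {set V}}, [/\ H \subset triples B, #|H| = r &
  forall S, #|S| = 4 -> #|H ::&: S| <> 2].

(** A 4-set with 4 or 3 points in the clique spans 4 edges or 1 edge. With at most 2 there, its
    edges all lie in [H], which never gives 2. *)
Lemma fills42_clique a r B : a <= #|B| ->
  (forall B', #|B'| = #|B| - a -> fills42 B' r) -> fills42 B (r + 'C(a, 3)).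
Proof.
move=> aB; have [A AB cA] := subset_card_exists aB.
case/(_ (B :\: A)) => [|H [H3 Hr HS]]; first by rewrite cardsD (setIidPr AB) cA.
have dis S : (triples A ::&: S) :&: (H ::&: S) = set0.
  apply/setP => T; rewrite !inE; apply/negP.
  move=> /andP[/andP[/andP[TA /eqP T3] _] /andP[/(subsetP H3)]].
  rewrite inE subsetD disjoint_sym => /andP[/andP[_ dTA] _] _.
  have := disjointWl TA dTA; rewrite -setI_eq0 setIid => /eqP T0.
  by rewrite T0 cards0 in T3.
have cE S : #|(triples A :|: H) ::&: S| = 'C(#|S :&: A|, 3) + #|H ::&: (S :&: (B :\: A))|.
  have -> : (triples A :|: H) ::&: S = (triples A ::&: S) :|: (H ::&: S).
    by apply/setP => T; rewrite !inE andb_orl.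
  rewrite cardsU dis cards0 subn0 (ssetI_setI S H3) -card_triples; congr (#|pred_of_set _| + _).
  by apply/setP => T; rewrite !inE subsetI; case: (T \subset S); rewrite ?andbT ?andbF.
have HV : H \subset triples setT.
  by apply: subset_trans H3 _; apply/subsetP => T; rewrite !inE subsetT => /andP[].
exists (triples A :|: H); split.
- rewrite subUset; apply/andP; split; apply/subsetP => T.
    by rewrite !inE => /andP[/subset_trans -> //].
  by move/(subsetP H3); rewrite !inE subsetD => /andP[/andP[->]].
- have := cE setT; rewrite !setTI cA.
  have ET (F : {set {set V}}) : F ::&: setT = F by apply/setP => T; rewrite inE subsetT andbT.
  have HB := ssetI_setI setT H3; rewrite setTI ET in HB.
  by rewrite ET -HB Hr addnC.
move=> S S4; rewrite cE.
have ab : #|S :&: A| + #|S :&: (B :\: A)| <= 4.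
  rewrite -S4 -(cardsID A S) leq_add2l; apply/subset_leq_card/subsetP => x.
  by rewrite !inE => /and3P[-> ->].
have t3 := card_ssetI_triples (S :&: (B :\: A)) HV.
have t4 := HS (S :&: (B :\: A)).
move: ab t3 t4; move: #|H ::&: (S :&: (B :\: A))| #|S :&: A| #|S :&: (B :\: A)| => t x y.
case: x => [|[|[|[|[|x]]]]] //; case: y => [|[|[|[|[|y]]]]] //; 
  rewrite ?bin3_small => _ t3 t4; by [exact: t4 | lia].
Qed.

Lemma fills42_small r B : 3 * r <= #|B| -> fills42 B r.
Proof.
elim: r B => [|r IHr] B rB.
  exists set0; split; rewrite ?sub0set ?cards0 // => S _.
  rewrite (_ : set0 ::&: S = set0) ?cards0 //.
  by apply/setP => T; rewrite !inE.
rewrite -addn1 -[1]/'C(3, 3); apply: fills42_clique => [|B' B'B]; first by lia.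
by apply: IHr; lia.
Qed.

(** A quadratic against a cubic. The bound 26 cannot be lowered to 25, where 300 > 286. *)
Lemma bin2_le_bin3_half a : 26 <= a -> 'C(a, 2) <= 'C(a./2.+1, 3).
Proof.
move=> a26; have ab : a <= a./2.*2.+1 by rewrite -{1}(odd_double_half a); case: odd.
move: (a./2) ab => b; rewrite -mul2n => ab.
have H1 : 'C(a, 2) <= 'C((2 * b).+1, 2) by apply: leq_bin2l.
have H2 := bin2_mul2 (2 * b).+1; have H3 := bin3_mul3 b.+1; have H4 := bin2_mul2 b.+1.
have b13 : 13 <= b by lia.
have [b' eb] : exists b', b = b'.+1 by exists b.-1; lia.
rewrite eb /= subSS subn1 /= in H1 H2 H3 H4 b13 *.
by nia.
Qed.

(* Greedy: the leftover after the largest clique K_a that fits is below C(a, 2),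
   which needs cliques on at most a/2 vertices. *)
Lemma fills42_greedy a r B :
  r < 'C(a.+1, 3) -> 2 * a + 3 * 'C(26, 3) <= #|B| -> fills42 B r.
Proof.
have [n] := ubnP a; elim: n a r B => // n IHn a r B an ra aB.
have [a26|a26] := ltnP a 26.
  (* Here r < C(26,3), and the reserved vertices suffice for [r] disjoint single edges. *)
  apply: fills42_small; apply: leq_trans aB; apply: leq_trans (leq_addl _ _).
  by rewrite leq_mul2l /= (leq_trans (ltnW ra)) // leq_bin2l.
have [ra'|ra'] := ltnP r 'C(a, 3).
  case: a an ra a26 aB ra' => // a an _ _ aB ra'.
  apply: (IHn a) => //; apply: leq_trans aB; rewrite leq_add2r; lia.
rewrite -(subnK ra'); apply: fills42_clique => [|B' cB'].
  by apply: leq_trans aB; lia.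
(* The clique uses [a] of the budgeted 2a vertices; the other [a] cover twice a/2. *)
apply: (IHn a./2); first by lia.
  by apply: leq_trans (bin2_le_bin3_half a26); rewrite binS3 in ra; lia.
by rewrite cB'; move: (3 * 'C(26, 3)) aB => K; lia.
Qed.
End FourTwo.

Lemma fillable42 : fillable (fun s t => s = 4 -> t <> 2).
Proof.
(* 384 = 6 * 4^3: with |B| <= 4(a - 1), C(a+1,3) >= |B|^3/384, which exceeds C|B|^2. *)
move=> C; exists (2 * (3 * 'C(26, 3)) + 384 * C + 10) => V B r BN rC.
suff [H [H3 Hr HS]] : fills42 B r by exists H; split=> // S _; apply: HS.
pose a := (#|B| - 3 * 'C(26, 3))./2.
apply: (@fills42_greedy _ a); last by rewrite /a; move: (3 * 'C(26, 3)) BN => K; lia.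
apply: leq_ltn_trans rC _.
have aB : #|B| <= 4 * (a.+1 - 2) by rewrite /a; move: (3 * 'C(26, 3)) BN => K; lia.
have CB : 384 * C < #|B| by move: (3 * 'C(26, 3)) BN => K; lia.
have H1 := bin3_lower a.+1.
have H2 : #|B| ^ 3 <= (4 * (a.+1 - 2)) ^ 3 by rewrite leq_exp2r.
rewrite expnMn in H2.
have H3 : 384 * C * #|B| ^ 2 < #|B| ^ 3.
  by rewrite [_ ^ 3]expnS ltn_pmul2r // expn_gt0; lia.
move: H1 H2 H3; move: (_ ^ 3) ('C(_, _)) (#|B| ^ 2) (#|B| ^ 3); lia.
Qed.

(** With c = 3 the set [A] is just one more disjoint clique. *)
Lemma mostly_avoidable42 : mostly_avoidable 4 2.
Proof.
apply: (mostly_avoidable_fill (c := 3) _ fillable42) => // a b t ab Pt tb.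
rewrite wide_countE3; move: ab tb Pt.
case: a => [|[|[|[|[|a]]]]] //; case: b => [|[|[|[|[|b]]]]] //; 
  rewrite ?bin3_small => _ t3 t4; by [exact: t4 | lia].
Qed.

(** * Arithmetic of the spanned edge counts *)

(** Truncated subtraction gives t = 0 when at most two points lie outside [A], as it should. *)
Definition sparse_value c m f :=
  exists a t, [/\ a <= m, t <= m - a - 2 & f = wide_count c a (m - a) + t].

Lemma avoidable_or_sparse_value c m f : 0 < c <= 3 ->
  mostly_avoidable m f \/ sparse_value c m f.
Proof.
move=> c3.
case: (boolP [exists a : 'I_m.+1, [exists t : 'I_m.+1,
    (t <= m - a - 2) && (f == wide_count c a (m - a) + t)]]).
  move=> /existsP[a /existsP[t /andP[ta /eqP fE]]]; right.
  by exists a, t; split=> //; rewrite -ltnS.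
move=> no; left.
apply: (mostly_avoidable_fill c3 (fillable_sparse m)) => a b t ab tb _ fE.
move/negP: no; apply; apply/existsP.
have am : a < m.+1 by rewrite -ab ltnS leq_addr.
have bE : m - a = b by rewrite -ab addKn.
have tb' : t <= b - 2 by apply: tb; rewrite -ab leq_addl.
have tm : t < m.+1 by lia.
exists (Ordinal am); apply/existsP; exists (Ordinal tm) => /=.
by rewrite bE tb' fE eqxx.
Qed.

Lemma bin2_ge_pred n : n - 1 <= 'C(n, 2).
Proof. by elim: n => [|[|n] IHn] //; rewrite binS2; lia. Qed.

Lemma bin_crossing m f : f < 'C(m, 3) -> exists2 x, x < m & 'C(x, 3) <= f < 'C(x.+1, 3).
Proof. by move=> fm; apply: nat_crossing. Qed.

(** From a = 2 on the left side is nondecreasing, since C(a,2) >= 1; the values at 0 and 1 are at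
    most m - 2. *)
Lemma bin3_add_bound m x a : a <= x -> x <= m ->
  'C(a, 3) + (m - a - 2) <= maxn (m - 2) ('C(x, 3) + (m - x - 2)).
Proof.
move=> ax xm; case: a ax => [|[|a]] ax; rewrite leq_max.
- by rewrite bin_small // subn0 leqnn.
- by rewrite bin_small //; apply/orP; left; lia.
apply/orP; right; have [k ek] : exists k, x = a.+2 + k by exists (x - a.+2); lia.
rewrite ek in xm *; elim: k xm {ax ek} => [|k IHk] xm; first by rewrite addn0.
apply: leq_trans (IHk _) _; first by lia.
by rewrite addnS binS3; have := bin2_ge_pred (a.+2 + k); lia.
Qed.

(** For a >= m - 1 there is no room for [t], so the value is a binomial coefficient outside the open
    interval. For smaller [a], [bin3_add_bound] stays below C(m-1,3) + 1. *)
Lemma near_full_not_sparse m f a t : 4 < m -> 'C(m.-1, 3) < f < 'C(m, 3) ->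
  a <= m -> t <= m - a - 2 -> f <> 'C(a, 3) + t.
Proof.
move=> m5 /andP[f1 f2] am tm fE.
have [am2|am2] := leqP a (m - 2); last first.
  have [ea|ea] : a = m.-1 \/ a = m by lia.
    by rewrite ea in fE tm; lia.
  by rewrite ea in fE; lia.
have := bin3_add_bound am2 (leq_subr 2 m).
have : m.-1 = (m - 2).+1 by lia.
move=> em; rewrite em binS3 in f1.
have C2 := bin2_ge_pred (m - 2).
have C3 : 0 < 'C(m - 2, 3) by rewrite bin_gt0; lia.
by rewrite leq_max => /orP[]; lia.
Qed.

(** The first form puts [f] within m - x - 2 above C(x,3), the second forces b = x + 1 and puts [f]
    within x - 1 below C(x+1,3). So C(x,2) <= m - 3, whence f < (m-2)(m-3)/3 < C(m-1,2). *)
Lemma sparse_and_cosparse_clique m f x a t b s : 3 < m -> x < m ->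
  'C(x, 3) < f < 'C(x.+1, 3) -> 'C(m.-1, 2) <= f ->
  a <= m -> t <= m - a - 2 -> f = 'C(a, 3) + t ->
  s <= b - 2 -> f + s <> 'C(b, 3).
Proof.
move=> m4 xm /andP[xf fx] mf am tm fE sb fE'.
have ax : a <= x.
  by rewrite leqNgt; apply/negP => /(leq_bin2l 3); lia.
have fup : f <= 'C(x, 3) + (m - x - 2).
  have : f <= maxn (m - 2) ('C(x, 3) + (m - x - 2)).
    by apply: leq_trans (bin3_add_bound ax (ltnW xm)); lia.
  rewrite leq_max => /orP[|//] fm.
  have := bin2_mul2 m.-1; nia.
have xb : x < b by rewrite ltnNge; apply/negP => /(leq_bin2l 3); lia.
have eb : b = x.+1.
  apply/eqP; rewrite eqn_leq xb andbT leqNgt; apply/negP.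
  case: b sb fE' {xb} => // b sb; rewrite binS3 ltnS => fE' /(leq_bin2l 3).
  by have := bin2_ge_pred b; lia.
rewrite eb binS3 in sb fE'; rewrite binS3 in fx.
have := bin3_mul3 x; have := bin2_mul2 m.-1.
have x2 : 1 < x by case: x fx {xm xf ax fup xb eb sb fE'} => [|[|x]].
have Cx : 'C(x, 2) <= m - 3 by lia.
have xm2 : x + 1 <= m - 2 by lia.
have := leq_mul Cx xm2.
by move: ('C(x, 2)) ('C(x, 3)) ('C(m.-1, 2)) fx mf; nia.
Qed.

Lemma clique_value m f : 0 < f -> f < 'C(m, 3) ->
  mostly_avoidable m f \/ exists2 x, 0 < x < m & f = 'C(x, 3).
Proof.
move=> f0 fm; have [x xm /andP[xf fx]] := bin_crossing fm.
have m3 : 3 < m by case: m fm {xm} => [|[|[|[|m]]]] //; case: f f0 {xf fx} => [|[|f]].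
have [ef|nef] := eqVneq 'C(x, 3) f.
  by right; exists x => //; rewrite xm andbT; case: x ef {xf fx xm} => // ef; rewrite -ef in f0.
have {}xf : 'C(x, 3) < f by rewrite ltn_neqAle nef.
have [/eqP[-> ->]|n42] := boolP ((m, f) == (4, 2)).
  by left; apply: mostly_avoidable42.
have compl : mostly_avoidable m ('C(m, 3) - f) -> mostly_avoidable m f.
  by rewrite -{2}(subKn (ltnW fm)); apply: mostly_avoidable_compl; rewrite leq_subr.
have mm : 'C(m, 3) = 'C(m.-1, 3) + 'C(m.-1, 2) by rewrite -{1}(ltn_predK m3) binS3.
(* For small [f] the complementary value exceeds C(m-1,3) and c = 3 is applied to it; otherwise c =
   3 is applied to [f] and c = 1 to the complementary value. *)
have [fsmall|flarge] := ltnP f 'C(m.-1, 2).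
  have [/compl|] := @avoidable_or_sparse_value 3 m ('C(m, 3) - f) isT; first by left.
  move=> [a [t [am tm]]]; rewrite wide_countE3 => fE; exfalso.
  have [m4|m5] : m = 4 \/ 4 < m by lia.
    move: n42 fsmall xf fx xm; rewrite m4 (_ : 'C(4.-1, 2) = 3) //.
    case: f f0 {fm nef compl fE} => [|[|[|f]]] // _ _ _.
    by case: x => [|[|[|[|x]]]].
  by apply: (near_full_not_sparse m5 _ am tm fE); lia.
have [MA|] := @avoidable_or_sparse_value 3 m f isT; first by left.
move=> [a [t [am tm]]]; rewrite wide_countE3 => fE.
have [/compl|] := @avoidable_or_sparse_value 1 m ('C(m, 3) - f) isT; first by left.
move=> [b [s [bm sm fE']]]; exfalso.
have := wide_count_total b (m - b); rewrite subnKC // => tot.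
apply: (@sparse_and_cosparse_clique m f x a t (m - b) s) => //; last by lia.
by rewrite xf fx.
Qed.

Section Wide2.
Variable m : nat.
Let W a := wide_count 2 a (m - a).

Lemma wide2S a : a < m -> W a.+1 = W a + a * (m - a.+1).
Proof. by move=> am; rewrite /W wide_countS // subnSK // !bin1. Qed.

Lemma wide2_mono a b : a <= b -> b <= m -> W a <= W b.
Proof.
move=> ab; have [k ->] : exists k, b = a + k by exists (b - a); lia.
elim: k {ab} => [|k IHk] km; first by rewrite addn0.
by rewrite addnS in km *; rewrite wide2S // (leq_trans (IHk (ltnW km))) ?leq_addr.
Qed.

(** Every triple has two points either in [A] or in its complement, never both. *)
Lemma wide2_dual a : a <= m -> W a + W (m - a) = 'C(m, 3).
Proof.
move=> am; have := wide_count_total a (m - a); rewrite subnKC // => ->.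
by rewrite /W subKn // !wide_countE2 wide_countE1; lia.
Qed.

(** For 0 < a < x the slack m - a - 2 is less than one step a(m - a - 1), so [W x] is not reached;
    for a = 0 the slack is only [W 2]. *)
Lemma sparse_wide2_upper f x : 0 < x -> x.+1 < m -> W x < f < W x.+1 ->
  sparse_value 2 m f -> f <= W x + (m - x - 2).
Proof.
move=> x0 xm /andP[xf fx] [a [t [am tm]]]; rewrite -/(W a) => fE.
have ax : a <= x.
  rewrite leqNgt; apply/negP => xa; have := wide2_mono xa am; lia.
have W1 : W 1 = 0 by rewrite wide2S /W ?wide_count0 //; lia.
have W2 : W 2 = m - 2 by rewrite wide2S ?W1 ?mul1n //; lia.
case: a am tm fE ax => [|a] am tm fE ax.
  have W0 : W 0 = 0 by rewrite /W wide_count0.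
  case: x x0 xm xf fx {ax} => [|[|x]] // _ xm xf fx; first by rewrite W2 in fx; lia.
  by have := @wide2_mono 2 x.+2 isT (ltnW (ltnW xm)); lia.
have [->|/= nax] := eqVneq x a.+1; first by rewrite fE leq_add2l.
have {}ax : a.+1 < x by rewrite ltn_neqAle eq_sym nax.
have := wide2_mono ax (ltnW (ltnW xm)); rewrite wide2S; last by lia.
by rewrite mulSn addnA => /(leq_trans (leq_addr _ _)); lia.
Qed.

(** If [f] lay strictly between [W x] and [W x.+1], the upper bounds for [f] and, by duality, for
    its complement would give x(m - x - 1) <= (m - x - 2) + (x - 1) = m - 3, impossible for 1 <= x
    <= m - 2. *)
Lemma wide_value f : 0 < f -> f < 'C(m, 3) ->
  mostly_avoidable m f \/ exists2 x, 0 < x < m & f = 'C(x, 3) + 'C(x, 2) * (m - x).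
Proof.
move=> f0 fm.
have [||x xm /andP[xf fx]] := @nat_crossing W m f.
- by rewrite /W wide_count0.
- by rewrite /W subnn wide_countn0.
have x0 : 0 < x.
  by case: x xm xf fx => // xm _; rewrite wide2S // mul0n addn0 /W wide_count0.
have [ef|nef] := eqVneq (W x) f.
  by right; exists x; rewrite ?x0 // -ef /W wide_countE2.
have {}xf : W x < f by rewrite ltn_neqAle nef.
have xm1 : x.+1 < m.
  rewrite ltn_neqAle xm andbT; apply/eqP => exm.
  by rewrite wide2S // exm subnn muln0 addn0 in fx; lia.
have [MA|S1] := @avoidable_or_sparse_value 2 m f isT; first by left.
have [MA|S2] := @avoidable_or_sparse_value 2 m ('C(m, 3) - f) isT.
  by left; rewrite -(subKn (ltnW fm)); apply: mostly_avoidable_compl; rewrite ?leq_subr.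
exfalso.
have D0 := wide2_dual (ltnW xm); have D1 := wide2_dual xm.
have e : (m - x.+1).+1 = m - x by lia.
have U1 := sparse_wide2_upper x0 xm1 _ S1; have U2 := @sparse_wide2_upper _ (m - x.+1) _ _ _ S2.
have {}U1 : f <= W x + (m - x - 2) by apply: U1; rewrite xf.
have {}U2 : 'C(m, 3) - f <= W (m - x.+1) + (m - (m - x.+1) - 2).
  by apply: U2; rewrite ?e; lia.
rewrite wide2S // in D1 fx.
have : x * (m - x.+1) <= m - 3 by lia.
by have : 0 < m - x.+1; nia.
Qed.
End Wide2.

(** * Forcing density *)

Lemma sigma3_le0 (R : realType) m f : mostly_avoidable m f -> (sigma3 R m f <= 0)%E.
Proof.
move=> MA; apply/lee_addgt0Pr => eps eps0; rewrite add0e.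
(* The forced proportion is at most 2(C(n,3) + d)/(d C(n,3)), hence at most 4/d once d <= C(n,3). *)
have [d d0 ed] : exists2 d, (0 < d)%N & (4%:R / d%:R <= eps)%R.
  exists (Num.trunc (4%:R / eps)%R).+1 => //.
  rewrite ler_pdivrMr ?ltr0n // mulrC -ler_pdivrMr //; apply: ltW.
  by have := truncnS_gt (4%:R / eps)%R.
have [n0 Hn0] := MA d.
rewrite /sigma3 /limn_esup /limf_esup.
pose tail := [set n | (maxn n0 (d + 3) <= n)%N]%classic.
apply: ge_ereal_inf; exists (ereal_sup [set ((num_forced3 m f n)%:R / ('C(n, 3))%:R)%:E
  | n in tail]%classic).
  exists tail => //.
  by exists (maxn n0 (d + 3)).
apply: ge_ereal_sup => _ [n nn <-]; rewrite /tail /= in nn.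
rewrite lee_fin; apply: le_trans ed.
have C0 : (d <= 'C(n, 3))%N.
  have : (n - 2 <= 'C(n, 3))%N.
    elim: n {nn} => [|[|[|n]] IHn] //; rewrite binS; have : (0 < 'C(n.+2, 2))%N by rewrite bin_gt0.
    move: IHn; lia.
  lia.
rewrite ler_pdivrMr ?ltr0n; last by lia.
rewrite mulrAC ler_pdivlMr ?ltr0n // -!natrM ler_nat.
have := @num_forced3_le m f d n (Hn0 n _); lia.
Qed.

Theorem theorem1p3 (R : realType) (m f : nat) (hm : (0 < m)%N)
  (hf0 : (0 < f)%N) (hf : (f < 'C(m, 3))%N) (hsigma : (0 < sigma3 R m f)%E) :
  exists x1 x2 x3 : nat,
    [/\ (0 < x1 < m)%N, (0 < x2 < m)%N & (0 < x3 < m)%N] /\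
    [/\ f = 'C(x1, 3),
        f = ('C(m, 3) - 'C(x2, 3))%N &
        f = ('C(x3, 3) + 'C(x3, 2) * (m - x3))%N].
Proof.
(* Positive density excludes avoidability of [f] and of its complementary value alike; the latter
   yields [x2]. *)
have notMA g : g <= 'C(m, 3) -> mostly_avoidable m g -> g = f \/ g = 'C(m, 3) - f -> False.
  move=> gm MA gE.
  have /(@sigma3_le0 R) : mostly_avoidable m f.
    case: gE => [<- // | gE]; rewrite -(subKn (ltnW hf)) -gE.
    exact: mostly_avoidable_compl.
  by rewrite leNgt hsigma.
have [MA|[x1 hx1 fx1]] := clique_value hf0 hf.
  by case: (notMA f (ltnW hf) MA); left.
have [MA|[x2 hx2 fx2]] := @clique_value m ('C(m, 3) - f) ltac:(lia) ltac:(lia).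
  by case: (notMA _ (leq_subr _ _) MA); right.
have [MA|[x3 hx3 fx3]] := wide_value hf0 hf.
  by case: (notMA f (ltnW hf) MA); left.
exists x1, x2, x3; split; split=> //.
by rewrite -fx2 subKn // ltnW.
Qed.
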